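(* Let $\alpha>2$, $\lambda_E>0$, $N\ge 1$, let $A_1,\dots,A_{N+1}$ be distinct points of $\mathbb{R}^2$ and let $p_{A_1},\dots,p_{A_N}>0$. Put $$\mathcal{P}_C=\exp\left[-\lambda_E\int_{\mathbb{R}^2}\left(1-\prod_{k=1}^{N}\frac{1}{1+\frac{p_{A_k}}{d_{A_k x}^{\alpha}}\sum_{i=1}^{N}\frac{d_{A_iA_{i+1}}^{\alpha}}{p_{A_i}}}\right)dx\right]$$ and, for a point $A\in\{A_1,\dots,A_N\}$, $$\mathcal{P}_{C\_approx}=\exp\left[-\lambda_E\int_{\mathbb{R}^2}\left(1-\prod_{k=1}^{N}\frac{1}{1+\frac{p_{A_k}}{d_{A x}^{\alpha}}\sum_{i=1}^{N}\frac{d_{A_iA_{i+1}}^{\alpha}}{p_{A_i}}}\right)dx\right].$$ Then $\mathcal{P}_C\le \mathcal{P}_{C\_approx}$ for every $A\in\{A_1,\dots,A_N\}$. Moreover, if all the transmit powers $p_{A_1},\dots,p_{A_N}$ are equal, then $$\mathcal{P}_{C\_approx}=\exp\left[-K_2(N)\left(\sum_{i=1}^{N}d_{A_iA_{i+1}}^{\alpha}\right)^{\frac{2}{\alpha}}\right],\qquad K_2(N)=\lambda_E\,\frac{\pi\,\Gamma\left(1-\frac{2}{\alpha}\right)\Gamma\left(\frac{2}{\alpha}+N\right)}{\Gamma(N)}.$$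
   Context: $d_{XY}$ denotes the Euclidean distance between the points $X,Y\in\mathbb{R}^2$, and $\Gamma$ is the gamma function. The quantity $\mathcal{P}_C$ is the secure connection probability of the path $A_1,\dots,A_{N+1}$ against colluding eavesdroppers forming a homogeneous Poisson point process of density $\lambda_E$. The integrands are defined for almost every $x\in\mathbb{R}^2$. *)

(* Defs.v *)
From HB Require Import structures.
From mathcomp Require Import all_boot all_order all_algebra.
From mathcomp Require Import all_classical all_reals all_analysis.

Set Implicit Arguments.
Unset Strict Implicit.
Unset Printing Implicit Defensive.

Import Order.TTheory GRing.Theory Num.Theory.
Import numFieldNormedType.Exports.
Local Open Scope classical_set_scope.
Local Open Scope ring_scope.

(* The norm that MathComp-Analysis puts on R * R is the sup norm, hence the
   explicit Euclidean distance. *)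
Definition eucl_dist (R : realType) (X Y : R * R) : R :=
  Num.sqrt ((X.1 - Y.1) ^+ 2 + (X.2 - Y.2) ^+ 2).

(* Euler's integral, which converges for 0 < s; it has no meaning as the Gamma
   function for s <= 0. *)
Definition Gamma (R : realType) (s : R) : R :=
  \int[@lebesgue_measure R]_(t in `]0, +oo[) (t `^ (s - 1) * expR (- t)).

Section SecureConnection.
Variables (R : realType) (alpha lambdaE : R) (N : nat).
(* The path A_1, ..., A_(N+1) is indexed from 0; for i < N, the hop number i
   goes from A (widen_ord (leqnSn N) i), of index i, to A (lift ord0 i), of
   index i + 1. *)
Variables (A : 'I_N.+1 -> R * R) (p : 'I_N -> R).

Definition tx (i : 'I_N) : R * R := A (widen_ord (leqnSn N) i).
Definition rx (i : 'I_N) : R * R := A (lift ord0 i).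

(* The integrands below are nonnegative and the integrals are taken in [0, +oo],
   so the exponentials take their values in [0, 1] (with exp (-oo) = 0) and no
   default value is involved.  Where a distance in a denominator vanishes (on
   finitely many x) the quotient is 0 by convention, which does not affect the
   integrals. *)
Definition P_C : \bar R :=
  expeR (- (lambdaE%:E * \int[@lebesgue_measure R \x @lebesgue_measure R]_x
    (1 - \prod_(k < N)
       (1 / (1 + p k / eucl_dist (tx k) x `^ alpha *
                 \sum_(i < N) eucl_dist (tx i) (rx i) `^ alpha / p i)))%:E))%E.

Definition P_C_approx (B : R * R) : \bar R :=
  expeR (- (lambdaE%:E * \int[@lebesgue_measure R \x @lebesgue_measure R]_x
    (1 - \prod_(k < N)
       (1 / (1 + p k / eucl_dist B x `^ alpha *
                 \sum_(i < N) eucl_dist (tx i) (rx i) `^ alpha / p i)))%:E))%E.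

Definition K2 : R :=
  lambdaE * (pi * Gamma (1 - 2 / alpha) * Gamma (2 / alpha + N%:R)
             / Gamma N%:R).

End SecureConnection.

(* Main.v *)
Require Import Defs.
From HB Require Import structures.
From mathcomp Require Import all_boot all_order all_algebra.
From mathcomp Require Import all_classical all_reals all_analysis.
From mathcomp Require Import measurable_realfun ring lra.

Set Implicit Arguments.
Unset Strict Implicit.
Unset Printing Implicit Defensive.

Import Order.TTheory GRing.Theory Num.Theory.
Import numFieldNormedType.Exports.
Local Open Scope classical_set_scope.
Local Open Scope ring_scope.

(* Both integrands are products of ratios t / (t + c) with t = d(x, A)^alpha,
   outside of the finitely many points where some distance vanishes.

   Inequality: the ratio t / (t + c) is the probability that a uniform u is at
   most t / (t + c). Hence, by Tonelli, the integral of
   1 - prod_k t_k / (t_k + c_k) is the average over independent thresholds u_k of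
   the area of the union of the discs t_k / (t_k + c_k) < u_k, centred at the A_k.
   Moving all the centres to the same point keeps the area of each disc and
   makes the discs nested, so that the area of the union drops to the largest
   of their areas.

   Closed form: for z = s / t,
     Gamma(N) (1 - (1 + z)^(-N))
       = int_0^oo y^(N-1) exp(-y) (1 - exp(-y z)) dy,
     1 - exp(-y z) = int_0^oo exp(-v) 1[v t < y s] dv.
   Integrating over the plane first, the disc v t < y s has area
   pi (y s / v)^(2/alpha), and the remaining integrals over v and y are Gamma
   integrals. *)

(** * Comparison of integrals of products *)

Lemma integral_threshold (R : realType) (a b : R) :
  0 <= a <= 1 -> 0 <= b <= 1 ->
  (\int[@lebesgue_measure R]_u
     ((1 - a * (u <= b)%R%:R) * \1_(`[0%R, 1%R[%classic : set R) u)%:E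
   = (1 - a * b)%:E)%E.
Proof.
move=> /andP[a0 a1] /andP[b0 b1].
transitivity (\int[@lebesgue_measure R]_u
    ((1 - a)%:E * (\1_(`[0%R, 1%R[%classic : set R) u)%:E
     + a%:E * (\1_(`]b, 1%R[%classic : set R) u)%:E))%E.
  apply: eq_integral => u _; rewrite -!EFinM -EFinD; congr EFin.
  rewrite !indicE !mem_setE !in_itv/=.
  have [ub|bu] := leP u b; have [u0|u0] := leP 0 u => /=; rewrite ?mulr0 ?mulr1 ?addr0//.
    by rewrite subr0 mul1r; case: (u < 1); rewrite /=; ring.
  by move: (le_lt_trans b0 bu); rewrite ltNge (ltW u0).
rewrite ge0_integralD//=; last 4 first.
- by move=> u _; rewrite -EFinM lee_fin mulr_ge0// subr_ge0.
- by apply: emeasurable_funM => //; apply/measurable_EFinP; exact: measurable_indic.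
- by move=> u _; rewrite -EFinM lee_fin mulr_ge0.
- by apply: emeasurable_funM => //; apply/measurable_EFinP; exact: measurable_indic.
rewrite !ge0_integralZl_EFin//; last 3 first.
- by apply/measurable_EFinP; exact: measurable_indic.
- by apply/measurable_EFinP; exact: measurable_indic.
- by rewrite subr_ge0.
rewrite !integral_indic// !setIT. rewrite /= !lebesgue_measure_itv/= !lte_fin ltr01.
case: ltP => b1'; last first.
  have -> : b = 1 by apply/eqP; rewrite eq_le b1.
  by rewrite mule0 adde0 -EFinB -EFinM; congr EFin; ring.
by rewrite -!EFinB -!EFinM -EFinD; congr EFin; ring.
Qed.

Lemma down_closed_total (T : Type) (R : realType) (rho : T -> R) (D E : set T) :
  (forall x y, rho x <= rho y -> D y -> D x) ->
  (forall x y, rho x <= rho y -> E y -> E x) ->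
  D `<=` E \/ E `<=` D.
Proof.
move=> Dd Ed; have [DE|] := pselect (D `<=` E); first by left.
move=> /existsNP[y /not_implyP[Dy nEy]]; right => x Ex.
have [/Dd|/ltW/Ed] := leP (rho x) (rho y); first exact.
by move=> /(_ Ex).
Qed.

Section comparison.
Context d (T : measurableType d) (R : realType).
Variables (mu : {sigma_finite_measure set T -> \bar R}) (rho : T -> R).
Variables (I : eqType) (f g : I -> T -> R).
Hypotheses (f01 : forall i x, 0 <= f i x <= 1) (g01 : forall i x, 0 <= g i x <= 1).
Hypotheses (mf : forall i, measurable_fun setT (f i))
           (mg : forall i, measurable_fun setT (g i)).
Hypothesis f_rho : forall i x y, rho x <= rho y -> f i x <= f i y.
Hypothesis f_le_g : forall i u,
  0 <= u < 1 -> (mu [set x | (f i x < u)%R] <= mu [set x | (g i x < u)%R])%E.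

Let meas_lt (h : I -> T -> R) (mh : forall i, measurable_fun setT (h i)) i u :
  measurable [set x | h i x < u].
Proof.
rewrite -[X in measurable X]setTI.
rewrite (_ : [set x | _] = (fun x => h i x < u) @^-1` [set true]).
  exact: (measurable_fun_ltr (mh i) (measurable_cst u)) measurableT _ _.
by apply/seteqP; split.
Qed.

Let prod01 (h : I -> T -> R) (h01 : forall i x, 0 <= h i x <= 1) (s : seq I)
  (D : set T) x : 0 <= \1_(~` D) x * \prod_(i <- s) h i x <= 1.
Proof.
apply/andP; split.
  by rewrite mulr_ge0// prodr_ge0// => i _; case/andP: (h01 i x).
rewrite mulr_ile1//; first by rewrite prodr_ge0// => i _; case/andP: (h01 i x).
by elim: s => [|i s IH]; rewrite ?big_nil// big_cons; case/andP: (h01 i x) => h0 h1;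
  rewrite mulr_ile1// prodr_ge0// => j _; case/andP: (h01 j x).
Qed.

Let meas_prod (h : I -> T -> R) (mh : forall i, measurable_fun setT (h i))
  (s : seq I) (D : set T) : measurable D ->
  measurable_fun setT (fun x => \1_(~` D) x * \prod_(i <- s) h i x).
Proof.
move=> mD; apply: measurable_funM; last by apply: measurable_prod => i _.
by apply: measurable_indic; exact: measurableC.
Qed.

Let slice (h : I -> T -> R) (s : seq I) i (D : set T) (z : T * R) : \bar R :=
  ((1 - \1_(~` (D `|` [set y | h i y < z.2])) z.1 * \prod_(j <- s) h j z.1) *
    \1_(`[0%R, 1%R[%classic : set R) z.2)%:E.

Let slice_ge0 (h : I -> T -> R) (h01 : forall i x, 0 <= h i x <= 1) s i D z :
  (0 <= slice h s i D z)%E.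
Proof.
rewrite lee_fin mulr_ge0// subr_ge0.
by have /andP[] := prod01 h01 s (D `|` [set y | h i y < z.2]) z.1.
Qed.

Let sliceE (h : I -> T -> R) s i D z : slice h s i D z =
  ((1 - (\1_(~` D) z.1 * \prod_(j <- s) h j z.1) * (z.2 <= h i z.1)%R%:R) *
    \1_(`[0%R, 1%R[%classic : set R) z.2)%:E.
Proof.
congr (_%:E); congr ((1 - _) * _).
rewrite !indicE mulrAC; congr (_ * _).
rewrite setCU in_setI !in_setC.
rewrite (_ : (z.1 \in [set y | h i y < z.2]) = (h i z.1 < z.2)).
  by rewrite -leNgt; case: (z.1 \in D) => /=; rewrite ?mul0r ?mul1r.
by apply/idP/idP => [/[!inE]|]; rewrite ?inE.
Qed.

Let measurable_slice (h : I -> T -> R) (mh : forall i, measurable_fun setT (h i))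
  s i D : measurable D -> measurable_fun setT (slice h s i D).
Proof.
move=> mD; rewrite (funext (sliceE h s i D)).
apply/measurable_EFinP; apply: measurable_funM; last first.
  exact: (measurableT_comp (measurable_indic (measurable_itv _)) measurable_snd).
apply: measurable_funB => //; apply: measurable_funM.
  exact: (measurableT_comp (meas_prod mh s mD) measurable_fst).
apply: (@measurableT_comp _ _ _ _ _ _ (fun b : bool => b%:R : R)) => //.
apply: measurable_fun_ler; first exact: measurable_snd.
exact: (measurableT_comp (mh i) measurable_fst).
Qed.

Let integral_slice (h : I -> T -> R) (h01 : forall i x, 0 <= h i x <= 1)
  (mh : forall i, measurable_fun setT (h i)) s i (D : set T) : measurable D ->
  (\int[mu]_x (1 - \1_(~` D) x * \prod_(j <- i :: s) h j x)%:E =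
   \int[@lebesgue_measure R]_u \int[mu]_x slice h s i D (x, u))%E.
Proof.
move=> mD.
apply: etrans; last exact: (@fubini_tonelli _ _ _ _ _ mu (@lebesgue_measure R)
  (slice h s i D) (measurable_slice mh s i mD) (slice_ge0 h01 s i D)).
apply: eq_integral => x _; under eq_integral do rewrite sliceE/=.
rewrite integral_threshold ?h01//; last exact: prod01.
by rewrite big_cons; congr EFin; ring.
Qed.

Lemma le_integral_prod_seq (s : seq I) (D S : set T) :
  measurable D -> measurable S ->
  (forall x y, rho x <= rho y -> D y -> D x) -> (mu D <= mu S)%E ->
  (\int[mu]_x (1 - \1_(~` D) x * \prod_(i <- s) f i x)%:E <=
   \int[mu]_x (1 - \1_(~` S) x * \prod_(i <- s) g i x)%:E)%E.
Proof.
elim: s D S => [|i s IH] D S mD mS Dd DS.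
  have E (h : I -> T -> R) (C : set T) : measurable C ->
      (\int[mu]_x (1 - \1_(~` C) x * \prod_(i <- [::]) h i x)%:E = mu C)%E.
    move=> mC; rewrite -(setIT C) -integral_indic//.
    apply: eq_integral => x _; rewrite big_nil mulr1 setIT !indicE in_setC.
    by case: (_ \in _); rewrite /= ?subrr ?subr0.
  by rewrite !E.
rewrite !integral_slice//; apply: ge0_le_integral => //.
- by move=> u _; apply: integral_ge0 => x _; exact: slice_ge0.
- exact: (@measurable_fun_fubini_tonelli_G _ _ _ _ _ mu
    (slice f s i D) (measurable_slice mf s i mD) (slice_ge0 f01 s i D)).
- exact: (@measurable_fun_fubini_tonelli_G _ _ _ _ _ mu
    (slice g s i S) (measurable_slice mg s i mS) (slice_ge0 g01 s i S)).
move=> u _; have [u01|u01] := boolP (u \in `[0%R, 1%R[); last first.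
  have E (h : I -> T -> R) C x : slice h s i C (x, u) = 0%E.
    rewrite /slice/= [X in _ * X]indicE memNset ?mulr0//= => u01'; by rewrite u01' in u01.
  by under eq_integral do rewrite E; under [leRHS]eq_integral do rewrite E.
have E (h : I -> T -> R) C x : slice h s i C (x, u) =
   (1 - \1_(~` (C `|` [set y | h i y < u])) x * \prod_(j <- s) h j x)%:E.
  by rewrite /slice/= [X in _ * X]indicE mem_set ?mulr1.
under eq_integral do rewrite E; under [leRHS]eq_integral do rewrite E.
have Fd x y : rho x <= rho y -> f i y < u -> f i x < u.
  by move=> xy; apply: le_lt_trans; exact: f_rho.
apply: IH.
- by apply: measurableU => //; exact: meas_lt.
- by apply: measurableU => //; exact: meas_lt.
- by move=> x y xy [/Dd|/Fd] => [/(_ _ xy) ?|/(_ _ xy) ?]; [left|right].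
have [sub|sub] := @down_closed_total _ _ _ D [set y | f i y < u] Dd Fd.
  rewrite ((setUidPr _ _).2 sub); apply: le_trans (f_le_g i u01) _.
  by apply: le_measure; rewrite ?inE; [exact: meas_lt| |exact: subsetUr];
    apply: measurableU => //; exact: meas_lt.
rewrite ((setUidPl _ _).2 sub); apply: le_trans DS _.
by apply: le_measure; rewrite ?inE//; apply: measurableU => //; exact: meas_lt.
Qed.

(* Integrated against independent uniform thresholds [u i], the integrand is the
   indicator of the union of the sublevel sets [h i x < u i]. For [h := f] these
   are nested, so that their union is one of them. *)
Lemma le_integral_prod (s : seq I) :
  (\int[mu]_x (1 - \prod_(i <- s) f i x)%:E <=
   \int[mu]_x (1 - \prod_(i <- s) g i x)%:E)%E.
Proof.
have := @le_integral_prod_seq s set0 set0 measurable0 measurable0 _ (lexx _).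
rewrite setC0 indicT; under eq_integral do rewrite mul1r.
by under [leRHS]eq_integral do rewrite mul1r; exact.
Qed.

End comparison.

(** * Area of a disc *)

Lemma integral_half_disc (R : realType) (a r : R) : 0 < r ->
  (\int[@lebesgue_measure R]_(x in `[(a - r)%R, (a + r)%R])
     (2 * Num.sqrt (r ^+ 2 - (a - x) ^+ 2))%:E = (pi * r ^+ 2)%:E)%E.
Proof.
move=> r0.
pose F (t : R) := a + r * sin t.
have dF (t : R) : is_derive t 1 F (r * cos t).
  rewrite -[r * cos t]add0r.
  exact: (is_deriveD (is_derive_cst a t 1) (is_deriveZ r (is_derive_sin t))).
have F'E : derive1 F = (fun t => r * cos t).
  by apply/funext => t; rewrite derive1E; exact: derive_val.
have cF : continuous F.
  by move=> t; apply/differentiable_continuous/derivable1_diffP; case: (dF t).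
have cF' : continuous (fun t : R => r * cos t).
  by move=> t; apply: continuousM; [exact: cst_continuous|exact: continuous_cos].
have pi2 : - (pi / 2) < pi / 2 :> R by have := pi_gt0 R; lra.
pose G (x : R) := 2 * Num.sqrt (r ^+ 2 - (a - x) ^+ 2).
have cG : continuous G.
  move=> x; apply: cvgM; first exact: cvg_cst.
  apply: (@cvg_comp _ _ _ (fun x : R => r ^+ 2 - (a - x) ^+ 2) Num.sqrt);
    last exact: sqrt_continuous.
  apply: cvgB; first exact: cvg_cst.
  apply: (@cvg_comp _ _ _ (fun x => a - x) (fun y : R => y ^+ 2)); last exact: exprn_continuous.
  by apply: cvgB; [exact: cvg_cst|exact: cvg_id].
have := @integration_by_substitution_increasing R F G (- (pi / 2)) (pi / 2) (ltW pi2).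
have -> : F (- (pi / 2)) = a - r by rewrite /F sinN sin_pihalf mulrN1.
have -> : F (pi / 2) = a + r by rewrite /F sin_pihalf mulr1.
rewrite F'E => ->.
- transitivity (\int[@lebesgue_measure R]_(t in `[(- (pi / 2))%R, (pi / 2)%R])
      (r ^+ 2 * (2 * cos t ^+ 2))%:E)%E.
    apply: eq_integral => t; rewrite inE/= in_itv/= => t2; congr EFin.
    have c0 := cos_ge0_pihalf t2.
    transitivity (G (F t) * (r * cos t)) => //; rewrite /G /F.
    rewrite (_ : r ^+ 2 - (a - (a + r * sin t)) ^+ 2 = (r * cos t) ^+ 2).
      rewrite sqrtr_sqr ger0_norm; last by rewrite mulr_ge0 ?(ltW r0).
      by ring.
    by rewrite [in RHS]exprMn cos2sin2; ring.
  pose H (t : R) := r ^+ 2 * (t + sin t * cos t).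
  have dH (t : R) : is_derive t 1 H (r ^+ 2 * (2 * cos t ^+ 2)).
    have -> : 2 * cos t ^+ 2 = 1 + (sin t * - sin t + cos t * cos t).
      by rewrite mulrN -!expr2 sin2cos2; ring.
    exact: (is_deriveZ (r ^+ 2) (is_deriveD (is_derive_id t 1)
      (is_deriveM (is_derive_sin t) (is_derive_cos t)))).
  have cH : continuous H.
    by move=> t; apply/differentiable_continuous/derivable1_diffP; case: (dH t).
  rewrite (@continuous_FTC2 _ _ H)//.
  + by rewrite /H sinN cosN cos_pihalf -EFinB; congr EFin; field.
  + apply: continuous_subspaceT => t; apply: cvgM; first exact: cvg_cst.
    apply: cvgM; first exact: cvg_cst.
    by apply: (@cvg_comp _ _ _ (@cos R) (fun y : R => y ^+ 2)); [exact: continuous_cos|exact: exprn_continuous].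
  + by split; [move=> t _; case: (dH t)|exact/cvg_at_right_filter/cH|exact/cvg_at_left_filter/cH].
  + by move=> t _; rewrite derive1E; exact: derive_val.
- move=> x y xI yI xy; rewrite /F ltrD2l ltr_pM2l//.
  by rewrite ltr_sin.
- by move=> t _; exact: cF'.
- by apply/cvg_ex; exists (r * cos (- (pi / 2))); exact/cvg_at_right_filter/cF'.
- by apply/cvg_ex; exists (r * cos (pi / 2)); exact/cvg_at_left_filter/cF'.
- by split; [move=> t _; case: (dF t)|exact/cvg_at_right_filter/cF|exact/cvg_at_left_filter/cF].
- exact/continuous_subspaceT.
Qed.

Lemma norm_lt_sqrtr (R : rcfType) (z e : R) : (`|z| < Num.sqrt e) = (z ^+ 2 < e).
Proof.
rewrite -sqrtr_sqr; have [e0|e0] := ltP 0 e; first by rewrite ltr_sqrt.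
rewrite (ler0_sqrtr e0) ltNge sqrtr_ge0 ltNge.
by rewrite (le_trans e0 (sqr_ge0 z)).
Qed.

Lemma disc_area (R : realType) (B : R * R) (r : R) : 0 <= r ->
  (@lebesgue_measure R \x @lebesgue_measure R)%E
    [set x | (B.1 - x.1) ^+ 2 + (B.2 - x.2) ^+ 2 < r] = (pi * r)%:E.
Proof.
rewrite le_eqVlt => /predU1P[<-|r0].
  rewrite mulr0 (_ : [set x | _] = set0) ?measure0//.
  rewrite -subset0 => x /=; rewrite ltNge; apply/negP/negPn.
  by rewrite addr_ge0// sqr_ge0.
have [s s0 ->] : exists2 s, 0 < s & r = s ^+ 2.
  by exists (Num.sqrt r); [rewrite sqrtr_gt0|rewrite sqr_sqrtr// ltW].
rewrite -(integral_half_disc B.1 s0) integral_mkcond.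
rewrite /product_measure1/=; apply: eq_integral => x _.
rewrite (_ : xsection _ x = ball B.2 (Num.sqrt (s ^+ 2 - (B.1 - x) ^+ 2))).
  rewrite lebesgue_measure_ball ?sqrtr_ge0// patchE; case: ifPn.
    by move=> _; rewrite mulr_natl.
  move=> /negP xB; rewrite ler0_sqrtr ?mul0rn// subr_le0.
  rewrite leNgt; apply/negP => xs; apply: xB; rewrite inE/= in_itv/=.
  have : `|B.1 - x| < s.
    by rewrite -(ger0_norm (ltW s0)) -(sqrtr_sqr s) norm_lt_sqrtr.
  by rewrite ltr_norml; lra.
apply/seteqP; split => y; rewrite /xsection /ball/= inE/= norm_lt_sqrtr; lra.
Qed.

(** * Gamma integrals *)

Section gamma.
Variable R : realType.
Local Notation mu := (@lebesgue_measure R).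

Definition eGamma (s : R) : \bar R :=
  (\int[mu]_(t in `]0%R, +oo[) (t `^ (s - 1) * expR (- t))%:E)%E.

Lemma measurable_expRN (D : set R) : measurable_fun D (fun v : R => expR (- v)).
Proof.
apply: measurable_funTS.
exact: (measurableT_comp (@measurable_expR R) (@oppr_measurable R setT)).
Qed.

Lemma measurable_powR_in (D : set R) (s : R) : measurable_fun D (fun t : R => t `^ s).
Proof. by apply: measurable_funTS; exact: measurable_powR. Qed.

Lemma measurable_exponential_pdf_in (D : set R) (c : R) :
  measurable_fun D (exponential_pdf c).
Proof. by apply: measurable_funTS; exact: measurable_exponential_pdf. Qed.

Lemma measurable_gamma_fun (D : set R) (s : R) :
  measurable_fun D (fun t : R => t `^ s * expR (- t)).
Proof.
by apply: measurable_funM; [exact: measurable_powR_in|exact: measurable_expRN].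
Qed.

Lemma gamma_fun_ge0 (s t : R) : 0 <= t `^ s * expR (- t).
Proof. by rewrite mulr_ge0 ?powR_ge0 ?expR_ge0. Qed.

Lemma integral_powR01_lty (s : R) : 0 < s ->
  (\int[mu]_(t in `]0%R, 1%R]) (t `^ (s - 1))%:E < +oo)%E.
Proof.
move=> s0.
pose F (n : nat) : set R := `[n.+1%:R^-1, 1]%classic.
have bF : \bigcup_n F n = `]0, 1]%classic.
  apply/seteqP; split => [t [n _]|t] /=.
    rewrite /F/= !in_itv/= => /andP[nt ->]; rewrite andbT.
    by apply: lt_le_trans nt; rewrite invr_gt0.
  rewrite in_itv/= => /andP[t0 t1]; exists (Num.bound t^-1) => //.
  rewrite /F/= in_itv/= t1 andbT -[leRHS]invrK lef_pV2 ?posrE ?invr_gt0//.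
  rewrite (le_trans (ltW (archi_boundP _))) ?invr_ge0 ?(ltW t0)//.
  by rewrite ler_nat.
have mp n : measurable_fun (F n) (fun t : R => (t `^ (s - 1))%:E).
  by apply/measurable_EFinP; apply: measurable_funTS; exact: measurable_powR.
have ndF : nondecreasing_seq F.
  move=> m n mn; apply/subsetPset => t; rewrite /F/= !in_itv/= => /andP[mt ->].
  by rewrite andbT (le_trans _ mt)// lef_pV2 ?posrE// ler_nat.
rewrite -bF; apply: le_lt_trans (ltry s^-1).
have cvgF := @ge0_nondecreasing_set_cvg_integral _ (measurableTypeR R) R F
  (fun t => (t `^ (s - 1))%:E) lebesgue_measure ndF (fun n => measurable_itv _) mp
  (fun n t _ => powR_ge0 _ _).
apply: cvge_le cvgF.
apply: nearW => -[|n].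
  by rewrite /F invr1 set_itv1 integral_set1 lee_fin invr_ge0 ltW.
have dG (t : R) : 0 < t -> is_derive t 1 (fun t => s^-1 * t `^ s) (t `^ (s - 1)).
  move=> t0; rewrite -[t `^ (s - 1)](mulKf (lt0r_neq0 s0)).
  exact: (is_deriveZ s^-1 (is_derive1_powR s t0)).
have cG (t : R) : 0 < t -> {for t, continuous (fun t => s^-1 * t `^ s)}.
  by move=> t0; apply/differentiable_continuous/derivable1_diffP; case: (dG t t0).
have cp (t : R) : 0 < t -> {for t, continuous (fun t : R => t `^ (s - 1))}.
  move=> t0; apply/differentiable_continuous/derivable1_diffP.
  by case: (is_derive1_powR (s - 1) t0).
have n1 : n.+2%:R^-1 < 1 :> R by rewrite invf_lt1 ?ltr1n.
have n0 : 0 < n.+2%:R^-1 :> R by rewrite invr_gt0.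
rewrite (@continuous_FTC2 _ _ (fun t => s^-1 * t `^ s))//.
- by rewrite powR1 mulr1 -EFinB lee_fin gerBl mulr_ge0 ?powR_ge0// invr_ge0 ltW.
- apply: continuous_in_subspaceT => t; rewrite inE/= in_itv/= => /andP[t0 _].
  by apply: cp; exact: lt_le_trans t0.
- split.
  + move=> t; rewrite in_itv/= => /andP[t0 _].
    by case: (dG t (lt_trans n0 t0)).
  + exact/cvg_at_right_filter/cG.
  + exact/cvg_at_left_filter/cG.
- move=> t; rewrite in_itv/= => /andP[t0 _]; rewrite derive1E.
  by have ? := dG t (lt_trans n0 t0); exact: derive_val.
Qed.

Lemma eGamma_lty (s : R) : 0 < s -> (eGamma s < +oo)%E.
Proof.
move=> s0; rewrite /eGamma.
have mf D : measurable_fun D (fun t : R => (t `^ (s - 1) * expR (- t))%:E).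
  by apply/measurable_EFinP; exact: measurable_gamma_fun.
rewrite (@itv_bndbnd_setU _ _ _ (BRight 1)) ?bnd_simp//.
rewrite ge0_integral_setU//; last 3 first.
- exact: mf.
- by move=> t _; rewrite lee_fin gamma_fun_ge0.
- apply/disj_setPS => t [] /=; rewrite !in_itv/= andbT => /andP[_ t1].
  by rewrite ltNge t1.
apply: lte_add_pinfty.
  apply: le_lt_trans (integral_powR01_lty s0); apply: ge0_le_integral => //.
  - by move=> t _; rewrite lee_fin gamma_fun_ge0.
  - exact: mf.
  - by apply/measurable_EFinP; exact: measurable_powR_in.
  - move=> t /=; rewrite in_itv/= => /andP[t0 _]; rewrite lee_fin ler_piMr ?powR_ge0//.
    by rewrite expR_le1 oppr_le0 ltW.
pose n := Num.bound s.
pose C : R := n.+1`!%:R * 2 ^+ n.+1 * 2.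
have C0 : 0 <= C by rewrite /C -natrX -!natrM.
have h0 : 0 < 2^-1 :> R by lra.
apply: (@le_lt_trans _ _ (\int[mu]_(t in `]1%R, +oo[) (C%:E * (exponential_pdf 2^-1 t)%:E))%E).
  apply: ge0_le_integral => //.
  - by move=> t _; rewrite lee_fin gamma_fun_ge0.
  - exact: mf.
  - apply: emeasurable_funM => //; apply/measurable_EFinP.
    exact: measurable_exponential_pdf_in.
  move=> t /=; rewrite in_itv/= andbT => t1; rewrite -EFinM lee_fin.
  have t0 : 0 < t by rewrite (lt_trans _ t1).
  rewrite exponential_pdfE ?(ltW t0) ?(ltW h0)//.
  have -> : C * (2^-1 * expR (- 2^-1 * t)) = (n.+1`!%:R * 2 ^+ n.+1 * expR (2^-1 * t)) * expR (- t).
    rewrite (_ : - t = (- 2^-1 * t) + (- 2^-1 * t)); last by field.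
    by rewrite expRD mulrA -[X in _ = X * _]mulrA mulNr expRxMexpNx_1 /C; field.
  rewrite ler_pM2r ?expR_gt0//.
  apply: (@le_trans _ _ (t ^+ n.+1)).
    rewrite -powR_mulrn ?(ltW t0)//; apply: ler_powR; first exact: ltW.
    have := archi_boundP (ltW s0); rewrite -/n => sn.
    by rewrite -natr1; lra.
  have := @expR_ge1Dxn R (2^-1 * t) n; rewrite mulr_ge0 ?(ltW t0) ?(ltW h0)// => /(_ isT).
  set e := expR _; rewrite exprMn => he.
  have f0 : 0 < n.+1`!%:R :> R by rewrite ltr0n fact_gt0.
  have : 2^-1 ^+ n.+1 * t ^+ n.+1 <= n.+1`!%:R * e.
    by rewrite -ler_pdivrMl// mulrC; apply: le_trans he; rewrite lerDr.
  rewrite exprVn mulrC ler_pdivrMr ?exprn_gt0//.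
  by rewrite mulrAC.
rewrite ge0_integralZl_EFin//; last 2 first.
- by move=> t _; rewrite lee_fin exponential_pdf_ge0// ltW.
- apply/measurable_EFinP; exact: measurable_exponential_pdf_in.
apply: lte_mul_pinfty => //.
apply: (@le_lt_trans _ _ 1%E); last exact: ltry.
rewrite -(integral_exponential_pdf h0); apply: ge0_subset_integral => //.
- by apply/measurable_EFinP; exact: measurable_exponential_pdf.
- by move=> t _; rewrite lee_fin exponential_pdf_ge0// ltW.
Qed.

Lemma eGamma_ge0 (s : R) : (0 <= eGamma s)%E.
Proof. by apply: integral_ge0 => t _; rewrite lee_fin gamma_fun_ge0. Qed.

Lemma EFin_Gamma (s : R) : 0 < s -> (Gamma s)%:E = eGamma s.
Proof.
by move=> s0; rewrite /Gamma /Rintegral fineK// ge0_fin_numE ?eGamma_lty// eGamma_ge0.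
Qed.

Lemma Gamma_ge0 (s : R) : 0 <= Gamma s.
Proof. by apply: Rintegral_ge0 => t _; exact: gamma_fun_ge0. Qed.

Lemma Gamma_gt0 (s : R) : 1 <= s -> 0 < Gamma s.
Proof.
move=> s1; rewrite -lte_fin EFin_Gamma; last exact: lt_le_trans s1.
apply: (@lt_le_trans _ _ (\int[mu]_(t in `[1%R, 2%R]) (expR (- 2))%:E)%E).
  rewrite integral_cst//= lebesgue_measure_itv/= lte_fin ltr1n -EFinB -EFinM.
  by rewrite lte_fin mulr_gt0 ?expR_gt0//; lra.
apply: (@le_trans _ _ (\int[mu]_(t in `[1%R, 2%R]) (t `^ (s - 1) * expR (- t))%:E)%E).
  apply: ge0_le_integral => //.
  - by apply/measurable_EFinP; exact: measurable_gamma_fun.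
  move=> t /=; rewrite in_itv/= => /andP[t1 t2]; rewrite lee_fin.
  apply: (@le_trans _ _ (expR (- t))); first by rewrite ler_expR lerN2.
  by rewrite ler_peMl ?expR_ge0// -[leLHS](powRr0 t) ler_powR// subr_ge0.
apply: ge0_subset_integral => //.
- by apply/measurable_EFinP; exact: measurable_gamma_fun.
- by move=> t _; rewrite lee_fin gamma_fun_ge0.
- by move=> t /=; rewrite !in_itv/= andbT => /andP[t1 _]; exact: lt_le_trans t1.
Qed.

End gamma.

Section exponential_integrals.
Variable R : realType.
Local Notation mu := (@lebesgue_measure R).

Lemma integral_expRN : (\int[mu]_(v in `]0%R, +oo[) (expR (- v))%:E = 1)%E.
Proof.
rewrite -(@integral_exponential_pdf R 1 ltr01) integral_itv_obnd_cbnd.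
  rewrite integral_mkcond; apply: eq_integral => v _.
  rewrite /exponential_pdf !patchE; case: ifPn => // _.
  by rewrite mul1r mulN1r.
by apply/measurable_EFinP; exact: measurable_expRN.
Qed.

Lemma integral_expRN_lt (w : R) : 0 < w ->
  (\int[mu]_(v in `]0%R, +oo[) (expR (- v) * (v < w)%R%:R)%:E
   = (1 - expR (- w))%:E)%E.
Proof.
move=> w0; have := @exponential_prob_itv0c R 1 w w0.
rewrite mulN1r -EFinB => <-; rewrite /exponential_prob.
rewrite (@integral_itv_bndoo _ _ _ _ true false); last first.
  by apply/measurable_EFinP; exact: measurable_exponential_pdf_in.
rewrite integral_mkcond [RHS]integral_mkcond; apply: eq_integral => v _.
rewrite !patchE !mem_setE !in_itv/= andbT; case: (ltP 0 v) => //= v0.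
case: ltP => _; rewrite ?mulr0// mulr1.
by rewrite exponential_pdfE ?(ltW v0)// mul1r mulN1r.
Qed.

Lemma eGamma_scale (n : nat) (c : R) : 0 < c ->
  (\int[mu]_(t in `]0%R, +oo[) (t ^+ n * expR (- (c * t)))%:E
   = (Gamma n.+1%:R / c ^+ n.+1)%:E)%E.
Proof.
move=> c0.
have cexp (k : R) : continuous (fun t : R => t ^+ n * expR (- (k * t))).
  move=> t; apply: cvgM; first exact: exprn_continuous.
  apply: (@cvg_comp _ _ _ (fun t : R => - (k * t)) expR); last exact: continuous_expR.
  by apply: cvgN; apply: cvgM; [exact: cvg_cst|exact: cvg_id].
have mexp (k : R) (D : set R) : measurable_fun D (fun t : R => (t ^+ n * expR (- (k * t)))%:E).
  by apply/measurable_EFinP; apply: measurable_funTS; exact: continuous_measurable_fun.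
have dF (t : R) : is_derive t 1 ( *%R c) c.
  by rewrite -[X in is_derive _ _ _ X]mulr1; exact: (is_deriveZ c (is_derive_id t 1)).
have F'E : derive1 ( *%R c) = cst c.
  by apply/funext => t; rewrite derive1E; exact: derive_val.
have := @increasing_ge0_integration_by_substitutiony R ( *%R c)
  (fun t : R => t ^+ n * expR (- (1 * t))) 0.
rewrite F'E mulr0 => subst.
have {subst} : (\int[mu]_(t in `[0%R, +oo[) (t ^+ n * expR (- (1 * t)))%:E =
   \int[mu]_(t in `[0%R, +oo[) ((c * t) ^+ n * expR (- (1 * (c * t))) * c)%:E)%E.
  apply: subst.
  - by move=> x y _ _; rewrite ltr_pM2l.
  - by move=> t _; exact: cst_continuous.
  - exact: is_cvg_cst.
  - exact: is_cvg_cst.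
  - split; first by move=> t _; case: (dF t).
    apply/cvg_at_right_filter/differentiable_continuous/derivable1_diffP.
    by case: (dF 0).
  - by apply: gt0_cvgMry => //; exact: cvg_id.
  - exact/continuous_subspaceT/cexp.
  - move=> t; rewrite in_itv/= andbT => t0.
    by rewrite mulr_ge0 ?expR_ge0// exprn_ge0// ltW.
rewrite -!integral_itv_obnd_cbnd; last 2 first.
- rewrite (_ : (fun t => _) = (fun t => (c ^+ n.+1)%:E * (t ^+ n * expR (- (c * t)))%:E)%E).
    by apply: emeasurable_funM => //; exact: mexp.
  by apply/funext => t; rewrite -EFinM exprMn mul1r exprSr; congr EFin; ring.
- exact: mexp.
have -> : (\int[mu]_(t in `]0%R, +oo[) (t ^+ n * expR (- (1 * t)))%:E = (Gamma n.+1%:R)%:E)%E.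
  rewrite EFin_Gamma//; apply: eq_integral => t.
  rewrite inE/= in_itv/= andbT => t0.
  by rewrite mul1r -natr1 addrK powR_mulrn// ltW.
have -> : (\int[mu]_(t in `]0%R, +oo[) ((c * t) ^+ n * expR (- (1 * (c * t))) * c)%:E =
   (c ^+ n.+1)%:E * \int[mu]_(t in `]0%R, +oo[) (t ^+ n * expR (- (c * t)))%:E)%E.
  rewrite -ge0_integralZl_EFin//.
  - by apply: eq_integral => t _; rewrite -EFinM exprMn mul1r exprSr; congr EFin; ring.
  - move=> t /=; rewrite in_itv/= andbT => t0.
    by rewrite lee_fin mulr_ge0 ?expR_ge0// exprn_ge0// ltW.
  - exact: mexp.
  - by rewrite exprn_ge0// ltW.
have cn : c ^+ n.+1 != 0 by rewrite expf_neq0// gt_eqF.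
move=> /(congr1 (fun e => ((c ^+ n.+1)^-1)%:E * e)%E).
by rewrite muleA -!EFinM mulVf// mul1e mulrC.
Qed.

End exponential_integrals.

(** * Integrals over the plane *)

(* Named in order to carry the sigma-finite structure that Tonelli's theorem needs. *)
Definition plane_measure (R : realType) := (@lebesgue_measure R \x @lebesgue_measure R)%E.
HB.instance Definition _ (R : realType) := Measure.on (@plane_measure R).
Lemma sigma_finite_plane_measure (R : realType) : sigma_finite setT (@plane_measure R).
Proof.
have /sigma_finiteP[F [TF ndF Foo]] := sigma_finiteT (@lebesgue_measure R).
exists (fun n => F n `*` F n).
  apply/seteqP; split => // -[x y] _.
  have [n _ Fx] : (\bigcup_i F i) x by rewrite -TF.
  have [m _ Fy] : (\bigcup_i F i) y by rewrite -TF.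
  exists (maxn n m) => //; split => /=.
    by have /subsetPset := ndF _ _ (leq_maxl n m); apply.
  by have /subsetPset := ndF _ _ (leq_maxr n m); apply.
move=> n; have [mF Fn] := Foo n; split; first exact: measurableX.
by rewrite /plane_measure/= product_measure1E// lte_mul_pinfty// ge0_fin_numE.
Qed.
HB.instance Definition _ (R : realType) := Measure_isSigmaFinite.Build _ _ _ (@plane_measure R) (sigma_finite_plane_measure R).

Section plane_integral.
Variables (R : realType) (alpha : R).
Hypothesis alpha_gt2 : 2 < alpha.
Local Notation mu := (@lebesgue_measure R).
Local Notation mu2 := (@plane_measure R).
Local Notation loss B x := (eucl_dist B x `^ alpha).

Lemma measurable_loss (B : R * R) : measurable_fun setT (fun x : R * R => loss B x).
Proof.
apply: (measurableT_comp (@measurable_powR R alpha)).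
apply: (measurableT_comp (continuous_measurable_fun (@sqrt_continuous R))).
by apply: measurable_funD; apply: measurable_funX; apply: measurable_funB.
Qed.

Lemma loss_lt_area (B : R * R) (y : R) : 0 <= y ->
  mu2 [set x | loss B x < y] = (pi * y `^ (2 / alpha))%:E.
Proof.
move=> y0; rewrite -(disc_area B (powR_ge0 _ _)); congr (plane_measure _).
apply/seteqP; have a0 : 0 < alpha by rewrite (lt_trans _ alpha_gt2).
have a2 : 0 < 2 / alpha by rewrite divr_gt0.
have dE x : (B.1 - x.1) ^+ 2 + (B.2 - x.2) ^+ 2 = loss B x `^ (2 / alpha).
  rewrite -powRrM mulrC divfK ?gt_eqF// powR_mulrn ?sqrtr_ge0//.
  by rewrite sqr_sqrtr// addr_ge0// sqr_ge0.
split => x /=; rewrite dE => xy.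
  by apply: gt0_ltr_powR; rewrite ?nnegrE ?powR_ge0.
rewrite ltNge; apply: contraTN xy => xy; rewrite -leNgt.
by apply: ge0_ler_powR; rewrite ?nnegrE ?powR_ge0// ltW.
Qed.

Lemma ge0_measurable_funV d (T : measurableType d) (f : T -> R) :
  measurable_fun setT f -> (forall x, 0 <= f x) ->
  measurable_fun setT (fun x => (f x)^-1).
Proof.
move=> mf f0; rewrite (_ : (fun x => _) = (fun x => f x `^ (-1))).
  exact: (measurableT_comp (@measurable_powR R (-1)) mf).
by apply/funext => x; rewrite powR_inv1.
Qed.

Lemma integral_oy_mkcond (f : R -> R) :
  (\int[mu]_(v in `]0%R, +oo[) (f v)%:E = \int[mu]_v (f v * (0 < v)%R%:R)%:E)%E.
Proof.
rewrite integral_mkcond; apply: eq_integral => v _.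
by rewrite patchE mem_setE in_itv/= andbT; case: ifPn => _; rewrite ?mulr1 ?mulr0.
Qed.

Lemma tonelli_oy d (T : measurableType d) (nu : {sigma_finite_measure set T -> \bar R})
    (h : T -> R -> R) :
  measurable_fun setT (fun z : T * R => h z.1 z.2) ->
  (forall x v, 0 < v -> 0 <= h x v) ->
  (\int[nu]_x \int[mu]_(v in `]0%R, +oo[) (h x v)%:E =
   \int[mu]_(v in `]0%R, +oo[) \int[nu]_x (h x v)%:E)%E.
Proof.
move=> mh h0; pose k (z : T * R) := (h z.1 z.2 * (0 < z.2)%R%:R)%:E.
under eq_integral do rewrite integral_oy_mkcond.
have mk : measurable_fun setT k.
  apply/measurable_EFinP; apply: measurable_funM => //.
  apply: (measurableT_comp (f := fun b : bool => b%:R : R)) => //.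
  by apply: measurable_fun_ltr => //; exact: measurable_snd.
have k0 z : (0 <= k z)%E.
  rewrite /k lee_fin; case: (ltP 0 z.2) => z0; rewrite ?mulr0// mulr1.
  exact: h0.
apply: etrans; first exact: (@fubini_tonelli _ _ _ _ _ nu mu k mk k0).
rewrite [RHS]integral_mkcond; apply: eq_integral => v _.
rewrite patchE mem_setE in_itv/= andbT /k/=; case: ifPn => v0.
  by apply: eq_integral => x _; rewrite mulr1.
by apply: integral0_eq => x _; rewrite mulr0.
Qed.

Let delta := 2 / alpha.

Let delta_gt0 : 0 < delta.
Proof. by rewrite divr_gt0// (lt_trans _ alpha_gt2). Qed.

Let delta_lt1 : delta < 1.
Proof. by rewrite ltr_pdivrMr ?mul1r// (lt_trans _ alpha_gt2). Qed.

Lemma integral_expR_loss (B : R * R) (c : R) : 0 < c ->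
  (\int[mu2]_x (1 - (loss B x != 0)%R%:R * expR (- (c / loss B x)))%:E
   = (pi * c `^ delta * Gamma (1 - delta))%:E)%E.
Proof.
move=> c0; pose h (x : R * R) (v : R) := expR (- v) * (v * loss B x < c)%R%:R.
transitivity (\int[mu2]_x \int[mu]_(v in `]0%R, +oo[) (h x v)%:E)%E.
  apply: eq_integral => x _; rewrite /h.
  have [->|t0] /= := eqVneq (loss B x) 0.
    by under eq_integral do rewrite mulr0 c0 mulr1; rewrite mul0r subr0 integral_expRN.
  have {}t0 : 0 < loss B x by rewrite lt_neqAle eq_sym t0 powR_ge0.
  by under eq_integral do rewrite -ltr_pdivlMr//; rewrite mul1r integral_expRN_lt// divr_gt0.
rewrite (@tonelli_oy _ _ mu2 h); last 2 first.
- apply: measurable_funM.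
    exact: (measurableT_comp (@measurable_expRN R setT) measurable_snd).
  apply: (measurableT_comp (f := fun b : bool => b%:R : R)) => //.
  apply: measurable_fun_ltr => //; apply: measurable_funM; first exact: measurable_snd.
  exact: (measurableT_comp (measurable_loss B) measurable_fst).
- by move=> x v _; rewrite mulr_ge0 ?expR_ge0.
rewrite EFinM EFin_Gamma ?subr_gt0// -ge0_integralZl_EFin//; last 3 first.
- by move=> v _; rewrite lee_fin gamma_fun_ge0.
- by apply/measurable_EFinP; exact: measurable_gamma_fun.
- by rewrite mulr_ge0 ?pi_ge0 ?powR_ge0.
apply: eq_integral => v; rewrite inE/= in_itv/= andbT => v0.
have mlt : measurable [set x : R * R | loss B x < c / v].
  rewrite -[X in measurable X]setTI.
  rewrite (_ : [set x | _] = (fun x => loss B x < c / v) @^-1` [set true]).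
    exact: (measurable_fun_ltr (measurable_loss B) (measurable_cst _)) measurableT _ _.
  by apply/seteqP; split.
transitivity ((expR (- v))%:E * mu2 [set x | (loss B x < c / v)%R])%E.
  rewrite -[in RHS](setIT [set x | _]) -integral_indic// -ge0_integralZl_EFin//.
  - apply: eq_integral => x _; rewrite /h -EFinM; congr (_ * _)%:E.
    rewrite indicE (_ : (x \in _) = (loss B x < c / v)).
      by rewrite ltr_pdivlMr// mulrC.
    by apply/idP/idP => [/[!inE]|]; rewrite ?inE.
  - by apply/measurable_EFinP; exact: measurable_indic.
rewrite loss_lt_area; last by rewrite divr_ge0 ?(ltW c0)// ltW.
rewrite -!EFinM; congr EFin; rewrite -/delta powRM ?invr_ge0 ?(ltW c0) ?(ltW v0)//.
rewrite -(powR_inv1 (ltW v0)) -powRrM mulN1r (_ : 1 - delta - 1 = - delta); last by ring.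
by ring.
Qed.

Lemma integral_gamma_ratio (n : nat) (t s : R) : 0 <= t -> 0 < s ->
  (\int[mu]_(y in `]0%R, +oo[)
     (y ^+ n * expR (- y) * (1 - (t != 0)%R%:R * expR (- (y * s / t))))%:E
   = (Gamma n.+1%:R * (1 - (t / (t + s)) ^+ n.+1))%:E)%E.
Proof.
move=> t0 s0; have G1 := eGamma_scale n (@ltr01 R); rewrite expr1n divr1 in G1.
have [->|tn0] /= := eqVneq t 0.
  rewrite mul0r expr0n subr0 mulr1 -G1; apply: eq_integral => y _.
  by rewrite mul0r subr0 mulr1 mul1r.
have {tn0}t0 : 0 < t by rewrite lt_neqAle eq_sym tn0.
have c0 : 0 < 1 + s / t by rewrite addr_gt0// divr_gt0.
have Gc := eGamma_scale n c0.
have mG c : measurable_fun (`]0, +oo[%classic : set R) (fun y : R => (y ^+ n * expR (- (c * y)))%:E).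
  apply/measurable_EFinP; apply: measurable_funM; first exact: exprn_measurable.
  apply: (measurableT_comp (@measurable_expRN R setT)); exact: mulrl_measurable.
have fE y : y ^+ n * expR (- y) * (1 - 1 * expR (- (y * s / t))) =
    y ^+ n * expR (- (1 * y)) - y ^+ n * expR (- ((1 + s / t) * y)).
  have -> : - ((1 + s / t) * y) = - (1 * y) - y * s / t.
    by rewrite mulrDl opprD mulrAC [s * y]mulrC.
  by rewrite expRD !mul1r; ring.
under eq_integral do rewrite fE.
set X := (\int[_]_(_ in _) _)%E.
have XE : (X + (Gamma n.+1%:R / (1 + s / t) ^+ n.+1)%:E = (Gamma n.+1%:R)%:E)%E.
  rewrite -Gc -G1 -ge0_integralD//.
  - by apply: eq_integral => y _; rewrite -EFinD subrK.
  - move=> y /=; rewrite in_itv/= andbT => y0; rewrite -fE lee_fin.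
    rewrite mulr_ge0 ?mulr_ge0 ?expR_ge0 ?exprn_ge0 ?(ltW y0)//.
    by rewrite subr_ge0 mul1r expR_le1 oppr_le0 ltW// divr_gt0// mulr_gt0.
  - by apply/measurable_EFinP; apply: measurable_funB; apply/measurable_EFinP; exact: mG.
  - move=> y /=; rewrite in_itv/= andbT => y0; rewrite lee_fin.
    by rewrite mulr_ge0 ?expR_ge0 ?exprn_ge0 ?(ltW y0).
  - exact: mG.
have -> : t / (t + s) = (1 + s / t)^-1.
  by field; rewrite !gt_eqF// addr_gt0.
by rewrite exprVn mulrBr mulr1 EFinB -XE addeK.
Qed.

Lemma integral_loss_ratio (B : R * R) (n : nat) (s : R) : 0 < s ->
  (\int[mu2]_x (1 - (loss B x / (loss B x + s)) ^+ n.+1)%:E =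
   (pi * Gamma (1 - delta) * Gamma (delta + n.+1%:R) / Gamma n.+1%:R * s `^ delta)%:E)%E.
Proof.
move=> s0.
have Gn0 : 0 < Gamma n.+1%:R :> R by rewrite Gamma_gt0// ler1n.
pose h (x : R * R) (y : R) :=
  y ^+ n * expR (- y) * (1 - (loss B x != 0)%R%:R * expR (- (y * s / loss B x))).
pose k (z : (R * R) * R) :=
  1 - (loss B z.1 != 0)%R%:R * expR (- (z.2 * s / loss B z.1)).
have mk : measurable_fun setT k.
  have mB : measurable_fun setT (fun z : (R * R) * R => loss B z.1).
    exact: (measurableT_comp (measurable_loss B) measurable_fst).
  apply: measurable_funB => //; apply: measurable_funM.
    apply: (measurableT_comp (f := fun b : bool => b%:R : R)) => //.
    by apply: measurable_neg; exact: measurable_fun_eqr.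
  apply: (measurableT_comp (@measurable_expRN R setT)).
  apply: measurable_funM; first by apply: measurable_funM; [exact: measurable_snd|].
  by apply: ge0_measurable_funV => // x; exact: powR_ge0.
have k0 x y : 0 < y -> 0 <= k (x, y).
  move=> y0; have e1 : expR (- (y * s / loss B x)) <= 1.
    by rewrite expR_le1 oppr_le0 divr_ge0 ?powR_ge0// mulr_ge0// ltW.
  by rewrite /k subr_ge0/=; case: (_ != _); rewrite ?mul1r ?mul0r.
have ls0 x : 0 < loss B x + s by rewrite ltr_wpDl// powR_ge0.
have swap : ((Gamma n.+1%:R)%:E * \int[mu2]_x (1 - (loss B x / (loss B x + s)) ^+ n.+1)%:E
   = \int[mu]_(y in `]0%R, +oo[) \int[mu2]_x (h x y)%:E)%E.
  rewrite -(@tonelli_oy _ _ mu2 h); last 2 first.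
  - apply: measurable_funM; first apply: measurable_funM.
    + by apply: measurable_funX; exact: measurable_snd.
    + exact: (measurableT_comp (@measurable_expRN R setT) measurable_snd).
    exact: mk.
  - move=> x y y0; rewrite /h mulr_ge0//.
      by rewrite mulr_ge0 ?expR_ge0// exprn_ge0// ltW.
    exact: k0.
  rewrite -ge0_integralZl_EFin//; last 3 first.
  - move=> x _; rewrite lee_fin subr_ge0 exprn_ile1//.
      by rewrite divr_ge0 ?powR_ge0// ltW.
    by rewrite ler_pdivrMr// mul1r lerDl ltW.
  - apply/measurable_EFinP; apply: measurable_funB => //; apply: measurable_funX.
    apply: measurable_funM; first exact: measurable_loss.
    apply: ge0_measurable_funV; last by move=> x; exact: ltW.
    by apply: measurable_funD => //; exact: measurable_loss.
  - exact: ltW.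
  by apply: eq_integral => x _; rewrite integral_gamma_ratio ?powR_ge0.
have {}swap : ((Gamma n.+1%:R)%:E * \int[mu2]_x (1 - (loss B x / (loss B x + s)) ^+ n.+1)%:E
   = (pi * s `^ delta * Gamma (1 - delta))%:E * (Gamma (delta + n.+1%:R))%:E)%E.
  rewrite {}swap EFin_Gamma ?addr_gt0// -ge0_integralZl_EFin//; last 3 first.
  - by move=> y _; rewrite lee_fin gamma_fun_ge0.
  - by apply/measurable_EFinP; exact: measurable_gamma_fun.
  - by rewrite mulr_ge0 ?mulr_ge0 ?pi_ge0 ?powR_ge0 ?Gamma_ge0.
  apply: eq_integral => y; rewrite inE/= in_itv/= andbT => y0.
  have ys0 : 0 < y * s by rewrite mulr_gt0.
  rewrite /h.
  under eq_integral do rewrite EFinM.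
  rewrite ge0_integralZl_EFin//; last 3 first.
  - by move=> x _; rewrite lee_fin; exact: k0.
  - apply/measurable_EFinP; exact: (measurableT_comp mk (pair2_measurable y)).
  - by rewrite mulr_ge0 ?expR_ge0// exprn_ge0// ltW.
  rewrite integral_expR_loss// -!EFinM; congr EFin.
  rewrite powRM ?(ltW y0) ?(ltW s0)//.
  have -> : delta + n.+1%:R - 1 = delta + n%:R by rewrite -natr1; ring.
  rewrite powRD; last by rewrite (gt_eqF y0) implybT.
  by rewrite powR_mulrn ?(ltW y0)//; ring.
move: swap => /(congr1 (fun e => ((Gamma n.+1%:R)^-1)%:E * e)%E).
rewrite muleA -!EFinM mulVf ?gt_eqF// mul1e => ->; congr EFin.
by field; rewrite gt_eqF.
Qed.

End plane_integral.

(** * Secure connection probabilities *)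

Section path.
Variables (R : realType) (alpha : R).
Hypothesis alpha_gt2 : 2 < alpha.
Local Notation mu2 := (@plane_measure R).
Local Notation loss B x := (eucl_dist B x `^ alpha).

Lemma eucl_dist_gt0 (X Y : R * R) : X != Y -> 0 < eucl_dist X Y.
Proof.
apply: contraNT; rewrite -leNgt /eucl_dist => d0.
have : Num.sqrt ((X.1 - Y.1) ^+ 2 + (X.2 - Y.2) ^+ 2) == 0.
  by rewrite eq_le d0 sqrtr_ge0.
rewrite sqrtr_eq0 le_eqVlt ltNge addr_ge0 ?sqr_ge0// orbF.
rewrite paddr_eq0 ?sqr_ge0// !sqrf_eq0 !subr_eq0 => /andP[/eqP e1 /eqP e2].
by rewrite [X]surjective_pairing [Y]surjective_pairing e1 e2.
Qed.

Lemma ae_loss_neq0 (I : finType) (b : I -> R * R) :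
  {ae mu2, forall x, forall k, loss (b k) x != 0}.
Proof.
apply: filter_forall => k; exists ([set (b k).1] `*` [set (b k).2]); split.
- exact: measurableX.
- by rewrite /plane_measure product_measure1E//= lebesgue_measure_set1 mul0e.
move=> x /=; apply: contra_notP => xb; apply/lt0r_neq0/powR_gt0/eucl_dist_gt0.
by apply/eqP => bx; apply: xb; rewrite bx.
Qed.

Lemma integral_prod_loss (I : finType) (b : I -> R * R) (p : I -> R) (S : R) :
  (forall k, 0 < p k) -> 0 < S ->
  (\int[mu2]_x (1 - \prod_k (1 / (1 + p k / loss (b k) x * S)))%:E =
   \int[mu2]_x (1 - \prod_k (loss (b k) x / (loss (b k) x + p k * S)))%:E)%E.
Proof.
move=> p0 S0.
have prod01 (h : I -> R) : (forall k, 0 <= h k <= 1) -> (0 <= (1 - \prod_k h k)%:E)%E.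
  by move=> h01; rewrite lee_fin subr_ge0; apply: prodr_ile1 => k _.
have l0 k x : 0 <= p k / loss (b k) x * S.
  by rewrite mulr_ge0 ?(ltW S0)// divr_ge0 ?powR_ge0// ltW.
have cS k : 0 < p k * S by rewrite mulr_gt0.
apply: ge0_ae_eq_integral => //.
- apply/measurable_EFinP; apply: measurable_funB => //.
  apply: measurable_prod => k _; apply: measurable_funM => //.
  apply: ge0_measurable_funV; last by move=> x; rewrite addr_ge0.
  apply: measurable_funD => //; apply: measurable_funM => //.
  apply: measurable_funM => //; apply: ge0_measurable_funV; last by move=> x; exact: powR_ge0.
  exact: measurable_loss.
- apply/measurable_EFinP; apply: measurable_funB => //.
  apply: measurable_prod => k _; apply: measurable_funM; first exact: measurable_loss.
  apply: ge0_measurable_funV; last by move=> x; rewrite addr_ge0 ?powR_ge0// ltW.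
  by apply: measurable_funD => //; exact: measurable_loss.
- move=> x _; apply: prod01 => k; rewrite div1r invr_ge0 addr_ge0//=.
  by rewrite invf_le1 ?lerDl// ltr_wpDr.
- move=> x _; apply: prod01 => k.
  by rewrite divr_ge0 ?addr_ge0 ?powR_ge0 ?(ltW (cS k))//= ler_pdivrMr ?mul1r ?lerDl ?(ltW (cS k))// ltr_wpDl// powR_ge0.
apply: (@filterS _ _ (ae_filter_ringOfSetsType mu2) _ _ _ (ae_loss_neq0 b)) => x ln0 _.
congr (1 - _)%:E; apply: eq_bigr => k _.
have lg0 : 0 < loss (b k) x by rewrite lt_neqAle eq_sym ln0 powR_ge0.
field; rewrite ln0 !gt_eqF ?addr_gt0//.
Qed.

Lemma ratio_lt (a c u : R) : 0 <= a -> 0 < c -> u < 1 ->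
  (a / (a + c) < u) = (a < u * c / (1 - u)).
Proof.
move=> a0 c0 u1; rewrite ltr_pdivrMr; last by rewrite ltr_wpDl.
rewrite ltr_pdivlMr ?subr_gt0//; apply/idP/idP; lra.
Qed.

Lemma le_integral_prod_loss (N : nat) (b : 'I_N -> R * R) (B : R * R) (c : 'I_N -> R) :
  (forall k, 0 < c k) ->
  (\int[mu2]_x (1 - \prod_(k < N) (loss B x / (loss B x + c k)))%:E <=
   \int[mu2]_x (1 - \prod_(k < N) (loss (b k) x / (loss (b k) x + c k)))%:E)%E.
Proof.
move=> c0.
have ratio01 C k x : 0 <= loss C x / (loss C x + c k) <= 1.
  rewrite divr_ge0 ?addr_ge0 ?powR_ge0 ?(ltW (c0 k))//=.
  by rewrite ler_pdivrMr ?mul1r ?lerDl ?(ltW (c0 k))// ltr_wpDl// powR_ge0.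
have mratio C k : measurable_fun setT (fun x : R * R => loss C x / (loss C x + c k)).
  apply: measurable_funM; first exact: measurable_loss.
  apply: ge0_measurable_funV; last by move=> x; rewrite addr_ge0 ?powR_ge0 ?(ltW (c0 k)).
  by apply: measurable_funD => //; exact: measurable_loss.
apply: (@le_integral_prod _ _ R mu2 (fun x => loss B x) _
  (fun k x => loss B x / (loss B x + c k)) (fun k x => loss (b k) x / (loss (b k) x + c k))).
- by move=> k x; exact: ratio01.
- by move=> k x; exact: ratio01.
- by move=> k; exact: mratio.
- by move=> k; exact: mratio.
- move=> k x y xy; have := powR_ge0 (eucl_dist B x) alpha; have := c0 k.
  set a := loss B x in xy *; set a' := loss B y in xy * => ck a0.
  have a'0 := le_trans a0 xy.
  rewrite ler_pdivrMr; last by rewrite ltr_wpDl.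
  rewrite mulrAC ler_pdivlMr; last by rewrite ltr_wpDl.
  nra.
- move=> k u /andP[u0 u1].
  have E C : mu2 [set x | loss C x / (loss C x + c k) < u] =
      (pi * (u * c k / (1 - u)) `^ (2 / alpha))%:E.
    rewrite -(loss_lt_area alpha_gt2 C); last by rewrite divr_ge0 ?mulr_ge0 ?(ltW (c0 k)) ?subr_ge0 ?(ltW u1).
    by congr (plane_measure _); apply/seteqP; split => x /=; rewrite ratio_lt ?powR_ge0.
  by have := lexx (pi * (u * c k / (1 - u)) `^ (2 / alpha))%:E; rewrite -{1}(E B) -(E (b k)).
Qed.

End path.

Theorem mainTheorem3 (R : realType) (alpha lambdaE : R) (N : nat)
    (A : 'I_N.+1 -> R * R) (p : 'I_N -> R)
    (alpha_gt2 : 2 < alpha) (lambdaE_gt0 : 0 < lambdaE) (N_ge1 : (1 <= N)%N)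
    (A_distinct : injective A) (p_gt0 : forall k, 0 < p k) :
  (forall m : 'I_N,
     (P_C alpha lambdaE A p <= P_C_approx alpha lambdaE A p (tx A m))%E) /\
  ((forall i j, p i = p j) ->
   forall m : 'I_N,
     P_C_approx alpha lambdaE A p (tx A m) =
     (expR (- (K2 alpha lambdaE N *
               (\sum_(i < N) eucl_dist (tx A i) (rx A i) `^ alpha)
                 `^ (2 / alpha))))%:E).
Proof.
have d0 i : 0 < eucl_dist (tx A i) (rx A i) `^ alpha.
  apply/powR_gt0/eucl_dist_gt0; rewrite /tx /rx (inj_eq A_distinct).
  by rewrite -val_eqE/= /bump leq0n add1n neq_ltn ltnSn.
have sum_gt0 (F : 'I_N -> R) : (forall i, 0 < F i) -> 0 < \sum_(i < N) F i.
  move=> F0; case: N N_ge1 F F0 {A p A_distinct p_gt0 d0} => // n _ F F0.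
  rewrite big_ord_recl ltr_pwDl// sumr_ge0// => i _; exact: ltW.
pose S := \sum_(i < N) eucl_dist (tx A i) (rx A i) `^ alpha / p i.
have S0 : 0 < S by apply: sum_gt0 => i; rewrite divr_gt0.
split => [m|pE m].
  rewrite /P_C /P_C_approx lee_expeR leeN2.
  apply: lee_wpmul2l; first by rewrite lee_fin ltW.
  have := @le_integral_prod_loss R alpha alpha_gt2 N (tx A) (tx A m) (fun k => p k * S).
  rewrite -(integral_prod_loss alpha (fun=> tx A m) p_gt0 S0).
  rewrite -(integral_prod_loss alpha (tx A) p_gt0 S0); apply=> k.
  by rewrite mulr_gt0.
rewrite /P_C_approx.
have E := integral_prod_loss alpha (fun=> tx A m) p_gt0 S0.
set s := \sum_(i < N) _.
have cE k : p k * S = s.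
  rewrite /S mulr_sumr; apply: eq_bigr => i _.
  by rewrite (pE i k) mulrC divfK// gt_eqF.
rewrite [X in (_ * X)%E](etrans E (_ : _ = (pi * Gamma (1 - 2 / alpha) *
  Gamma (2 / alpha + N%:R) / Gamma N%:R * s `^ (2 / alpha))%:E)).
  by rewrite -EFinM -EFinN /=; congr (expR (- _))%:E; rewrite /K2; ring.
have s0 : 0 < s by exact: sum_gt0.
clearbody s.
transitivity (\int[plane_measure (R:=R)]_x
    (1 - (eucl_dist (tx A m) x `^ alpha / (eucl_dist (tx A m) x `^ alpha + s)) ^+ N)%:E)%E.
  apply: eq_integral => x _; congr (1 - _)%:E.
  by under eq_bigr do rewrite cE; rewrite prodr_const card_ord.
by move: (tx A m) => B; rewrite -(prednK N_ge1) (integral_loss_ratio alpha_gt2).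
Qed.
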